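(* Let $E=(E^0,E^1,d,r)$ be a topological graph. For $v\in BV(E)$ put $\rho_v=(X^0,X^0_{\rm sg}\cup\{v\})$ where $X^0=\overline{\mathrm{Orb}^+(v)}$, and for $X^0\in\mathcal{M}(E)$ put $\rho_{X^0}=(X^0,X^0_{\rm sg})$. The map $x\mapsto\rho_x$ gives a bijection from the disjoint union $BV(E)\amalg\mathcal{M}(E)$ to the set of all prime admissible pairs of $E$.
   Context: A topological graph $E=(E^0,E^1,d,r)$ consists of two locally compact (Hausdorff) spaces $E^0,E^1$, a local homeomorphism $d\colon E^1\to E^0$ and a continuous map $r\colon E^1\to E^0$. Put $E^0_{\rm sce}=E^0\setminus\overline{r(E^1)}$, $E^0_{\rm fin}=\{v\in E^0: v$ has a neighborhood $V$ with $r^{-1}(V)$ compact$\}$, $E^0_{\rm rg}=E^0_{\rm fin}\setminus\overline{E^0_{\rm sce}}$, $E^0_{\rm sg}=E^0\setminus E^0_{\rm rg}$. $X^0\subset E^0$ is positively invariant if $d(e)\in X^0$ implies $r(e)\in X^0$ for $e\in E^1$; negatively invariant if for every $v\in X^0\cap E^0_{\rm rg}$ there is $e\in E^1$ with $r(e)=v$, $d(e)\in X^0$; invariant if both. For a closed positively invariant $X^0$ put $X^1=d^{-1}(X^0)$; then $X=(X^0,X^1,d|_{X^1},r|_{X^1})$ is a topological graph, and $X^0_{\rm rg},X^0_{\rm sg}$ are computed in $X$. An admissible pair is a pair $\rho=(X^0,Z)$ of closed subsets of $E^0$ with $X^0$ invariant and $X^0_{\rm sg}\subset Z\subset E^0_{\rm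 sg}\cap X^0$. Write $(X_1^0,Z_1)\subset(X_2^0,Z_2)$ if $X_1^0\subset X_2^0$ and $Z_1\subset Z_2$, and $(X_1^0,Z_1)\cup(X_2^0,Z_2)=(X_1^0\cup X_2^0,Z_1\cup Z_2)$ (again admissible). An admissible pair $\rho$ is prime if $\rho_1\cup\rho_2\supset\rho$ implies either $\rho_1\supset\rho$ or $\rho_2\supset\rho$ for two admissible pairs $\rho_1,\rho_2$. $\mathrm{Orb}^+(v)$ is the set consisting of $v$ and all $r(e_1)$ for paths $(e_1,\dots,e_n)\in(E^1)^n$, $n\ge1$, with $d(e_k)=r(e_{k+1})$ for $1\le k<n$ and $d(e_n)=v$. $BV(E)$ is the set of $v\in E^0_{\rm sg}$ such that $v\in X^0_{\rm rg}$, where $X^0=\overline{\mathrm{Orb}^+(v)}$ (which is invariant since $v\in E^0_{\rm sg}$). A maximal head is a non-empty closed invariant set $X^0\subset E^0$ such that for any $v_1,v_2\in X^0$ and any neighborhoods $V_1,V_2$ of $v_1,v_2$ respectively there is $v\in X^0$ with $\mathrm{Orb}^+(v)\cap V_1\neq\emptyset$ and $\mathrm{Orb}^+(v)\cap V_2\neq\emptyset$; $\mathcal{M}(E)$ is the set of all maximal heads.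
   Formalization: The admissible pair (∅,∅) is excluded from the prime admissible pairs: it satisfies the stated definition of prime vacuously, but is never of the form ρ_x, since orbit closures and maximal heads are non-empty. *)

(* Defs.v *)
From HB Require Import structures.
From mathcomp Require Import all_boot all_order all_algebra.
From mathcomp Require Import all_classical all_reals topology.
Set Implicit Arguments.
Unset Strict Implicit.
Unset Printing Implicit Defensive.
Local Open Scope classical_set_scope.

Section SetType.
Variables (T : topologicalType) (A : set T).

Lemma nbhs_set_type (x : A) (W : set A) :
  nbhs x W <-> exists2 V, nbhs (set_val x) V & @set_val T A @^-1` V `<=` W.
Proof.
split=> [[_ [[V oV <-] Vx] VW]|[V Vx VW]].
  by exists V => //; apply: open_nbhs_nbhs.
by apply: filterS VW _; exact: (@initial_continuous A T set_val).
Qed.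

Lemma set_type_hausdorff : hausdorff_space T -> hausdorff_space A.
Proof.
move=> hT x y xy; apply: val_inj; apply: hT => B C Bx Cy.
have [] := xy (@set_val T A @^-1` B) (@set_val T A @^-1` C).
- by apply/nbhs_set_type; exists B.
- by apply/nbhs_set_type; exists C.
by move=> z [Bz Cz]; exists (set_val z).
Qed.

Lemma set_type_compact (K : set T) :
  closed A -> compact K -> compact (@set_val T A @^-1` K).
Proof.
move=> cA cK F PF FK.
have PG : ProperFilter (@set_val T A @ F) by exact: fmap_proper_filter.
have [x [Kx clx]] := cK _ PG FK.
have Ax : A x.
  apply: cA => B Bx.
  have [|z [Az Bz]] := clx A B _ Bx; last by exists z.
  by apply: (@filterS _ F _ _ _ _ FK) => z _ /=; exact: set_valP.
exists (SigSub (mem_set Ax)); split=> // B C FB /nbhs_set_type[V Vx VC].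
have [|_ [[z Bz <-] Vz]] := clx (@set_val T A @` B) V _ Vx.
  by apply: (@filterS _ F _ _ _ _ FB) => z Bz /=; exists z.
by exists z; split=> //; exact: VC.
Qed.

Lemma set_type_locally_compact : hausdorff_space T -> closed A ->
  locally_compact [set: T] -> locally_compact [set: A].
Proof.
move=> hT cA lT x _; have [K Kx [cK clK]] := lT (set_val x) I.
have cK' := set_type_compact cA cK.
exists (@set_val T A @^-1` K).
  apply/nbhs_set_type; exists K => //.
  by apply: (@filterS _ (nbhs (set_val x)) _ _ _ _ Kx) => z; exact.
by split=> //; exact: (compact_closed (set_type_hausdorff hT)).
Qed.

End SetType.

(* Every point has an open neighborhood U with open image such that f restricts
   to a homeomorphism from U onto f @` U; only the values of g on f @` U are
   relevant. *)
Definition local_homeomorphism (X Y : topologicalType) (f : X -> Y) : Prop :=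
  forall x, exists U : set X,
    [/\ open U, U x, open (f @` U) &
        exists g : Y -> X, [/\ {within U, continuous f},
          {within f @` U, continuous g} & {in U, cancel f g}]].

Record topGraph := TopGraph {
  vert : topologicalType;
  edge : topologicalType;
  dom : edge -> vert;
  rng : edge -> vert;
  vert_hausdorff : hausdorff_space vert;
  edge_hausdorff : hausdorff_space edge;
  vert_locally_compact : locally_compact [set: vert];
  edge_locally_compact : locally_compact [set: edge];
  dom_local_homeo : local_homeomorphism dom;
  rng_continuous : continuous rng }.

Section Vertices.
Variable E : topGraph.

Definition sce : set (vert E) := ~` closure (range (@rng E)).

Definition fin : set (vert E) :=
  [set v | exists2 V, nbhs v V & compact (@rng E @^-1` V)].

Definition rg : set (vert E) := fin `\` closure sce.

Definition sg : set (vert E) := ~` rg.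

Definition positively_invariant (X : set (vert E)) : Prop :=
  forall e : edge E, X (dom e) -> X (rng e).

Definition negatively_invariant (X : set (vert E)) : Prop :=
  forall v, (X `&` rg) v -> exists2 e : edge E, rng e = v & X (dom e).

Definition invariant (X : set (vert E)) : Prop :=
  positively_invariant X /\ negatively_invariant X.

(* A path (e_1, ..., e_n) with n >= 1 is given by its head e_1 and its tail. *)
Definition orb_plus (v : vert E) : set (vert E) :=
  [set w | w = v \/ exists (e : edge E) (p : seq (edge E)),
    [/\ path (fun e1 e2 => dom e1 == rng e2) e p,
        dom (last e p) = v & rng e = w]].

Lemma dom_open (W : set (edge E)) : open W -> open (@dom E @` W).
Proof.
move=> oW; rewrite openE => _ [e We <-].
have [U [oU Ue odU [g [_ cg gK]]]] := dom_local_homeo e.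
have dUe : (@dom E @` U) (dom e) by exists e.
have cge : {for dom e, continuous g}.
  by move: cg; rewrite continuous_open_subspace//; apply; rewrite inE.
have gW : \forall z \near dom e, W (g z).
  by apply: cge; rewrite gK ?inE//; exact: open_nbhs_nbhs.
have gU : \forall z \near dom e, (@dom E @` U) z by exact: open_nbhs_nbhs.
apply: filterS2 gW gU => z Wgz [f Uf dfz].
by exists f => //; rewrite -[f]gK ?inE// dfz.
Qed.

Lemma dom_continuous : continuous (@dom E).
Proof.
move=> e; have [U [oU Ue _ [g [cd _ _]]]] := dom_local_homeo e.
by move: cd; rewrite continuous_open_subspace//; apply; rewrite inE.
Qed.

Lemma orb_rng (v : vert E) (e : edge E) :
  orb_plus v (dom e) -> orb_plus v (rng e).
Proof.
case=> [dev|[f [p [fp lpv rfe]]]]; right; first by exists e, [::].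
by exists e, (f :: p); rewrite /= rfe eqxx.
Qed.

Lemma closure_orb_posinv (v : vert E) :
  positively_invariant (closure (orb_plus v)).
Proof.
move=> e cle W; rewrite nbhsE => -[V [oV Vre] VW].
have oU : open (@rng E @^-1` V).
  by move/continuousP : (@rng_continuous E); exact.
have [|w [vw [f /= Vf dfw]]] := cle (@dom E @` (@rng E @^-1` V)).
  by apply: open_nbhs_nbhs; split; [exact: dom_open|exists e].
by exists (rng f); split; [apply: orb_rng; rewrite dfw|exact: VW].
Qed.

End Vertices.

Arguments sce : clear implicits.
Arguments fin : clear implicits.
Arguments rg : clear implicits.
Arguments sg : clear implicits.

Section Subgraph.
Variables (E : topGraph) (X : set (vert E)).
Hypotheses (cX : closed X) (pX : positively_invariant X).

Local Notation X1 := (@dom E @^-1` X).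

Definition sub_dom (e : X1) : X :=
  SigSub (mem_set (set_valP e : X (dom (val e)))).

Definition sub_rng (e : X1) : X :=
  SigSub (mem_set (pX (set_valP e) : X (rng (val e)))).

Lemma sub_dom_local_homeo : local_homeomorphism sub_dom.
Proof.
move=> e.
have [U [oU Ue odU [g [cd cg gK]]]] := dom_local_homeo (set_val e).
pose U' := @set_val _ X1 @^-1` U.
have oU' : open U' by exists U.
have dU'E : sub_dom @` U' = @set_val _ X @^-1` (@dom E @` U).
  apply/seteqP; split=> [_ [f Uf <-]|y [f Uf dfy]]; first by exists (set_val f).
  have X1f : X1 f by rewrite /= dfy; exact: set_valP.
  by exists (SigSub (mem_set X1f)) => //; exact: val_inj.
have odU' : open (sub_dom @` U') by rewrite dU'E; exists (@dom E @` U).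
exists U'; split=> //; exists (fun y => insubd e (g (set_val y))).
have gv (y : X) : (@dom E @` U) (set_val y) ->
    val (insubd e (g (set_val y))) = g (set_val y).
  move=> [f Uf fy]; rewrite val_insubd ifT// -fy gK ?inE//.
  by rewrite /= fy; exact: set_valP.
split.
- rewrite continuous_open_subspace// => f _ W /nbhs_set_type[V Vf VW].
  apply/nbhs_set_type; exists (@dom E @^-1` V); first exact: dom_continuous.
  by move=> z Vz; exact: VW.
- rewrite continuous_open_subspace// => y; rewrite inE dU'E /= => dUy.
  move=> W /nbhs_set_type[V]; rewrite set_valE gv// => Vg VW.
  have cgy : {for set_val y, continuous g}.
    by move: cg; rewrite continuous_open_subspace//; apply; rewrite inE.
  apply/nbhs_set_type; exists ((g @^-1` V) `&` (@dom E @` U)).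
    by apply: filterI; [exact: cgy|exact: open_nbhs_nbhs].
  by move=> z [Vgz dUz]; apply: VW; rewrite /= set_valE gv.
- move=> f; rewrite inE => Uf; apply: val_inj.
  rewrite gv; last by exists (set_val f).
  by rewrite set_valE /= gK ?inE.
Qed.

Lemma sub_rng_continuous : continuous sub_rng.
Proof.
move=> e W /nbhs_set_type[V Ve VW].
apply/nbhs_set_type; exists (@rng E @^-1` V); first exact: rng_continuous.
by move=> z Vz; exact: VW.
Qed.

Lemma closed_dom_preimage : closed X1.
Proof.
by apply: preimage_closed => // e _; exact: dom_continuous.
Qed.

Definition subgraph : topGraph := @TopGraph X X1 sub_dom sub_rng
  (set_type_hausdorff (@vert_hausdorff E))
  (set_type_hausdorff (@edge_hausdorff E))
  (set_type_locally_compact (@vert_hausdorff E) cX (@vert_locally_compact E))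
  (set_type_locally_compact (@edge_hausdorff E) closed_dom_preimage
    (@edge_locally_compact E))
  sub_dom_local_homeo sub_rng_continuous.

(* The sets of regular and singular vertices of the graph carried by X, pushed
   forward from the subtype X to E^0. *)
Definition sub_rg : set (vert E) := @set_val _ X @` rg subgraph.

Definition sub_sg : set (vert E) := @set_val _ X @` sg subgraph.

End Subgraph.

Section PrimePairs.
Variable E : topGraph.

Record admissible (rho : set (vert E) * set (vert E)) : Prop := Admissible {
  adm_closed : closed rho.1;
  adm_invariant : invariant rho.1;
  adm_closed2 : closed rho.2;
  adm_sub_sg : sub_sg adm_closed (proj1 adm_invariant) `<=` rho.2;
  adm_sub : rho.2 `<=` sg E `&` rho.1 }.

Definition pair_sub (rho1 rho2 : set (vert E) * set (vert E)) : Prop :=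
  rho1.1 `<=` rho2.1 /\ rho1.2 `<=` rho2.2.

Definition pair_union (rho1 rho2 : set (vert E) * set (vert E)) :
    set (vert E) * set (vert E) :=
  (rho1.1 `|` rho2.1, rho1.2 `|` rho2.2).

(* As for prime ideals, which are proper, the admissible pair (set0, set0) is
   not counted as prime although it satisfies the implication trivially. *)
Definition prime_pairs : set (set (vert E) * set (vert E)) :=
  [set rho | [/\ admissible rho, rho <> (set0, set0) &
    forall rho1 rho2, admissible rho1 -> admissible rho2 ->
      pair_sub rho (pair_union rho1 rho2) ->
      pair_sub rho rho1 \/ pair_sub rho rho2]].

Definition orb_sub_rg (v : vert E) : set (vert E) :=
  sub_rg (@closed_closure _ (orb_plus v)) (@closure_orb_posinv E v).

Definition orb_sub_sg (v : vert E) : set (vert E) :=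
  sub_sg (@closed_closure _ (orb_plus v)) (@closure_orb_posinv E v).

Definition BV : set (vert E) := [set v | sg E v /\ orb_sub_rg v v].

Record maximal_head (X : set (vert E)) : Prop := MaximalHead {
  mh_nonempty : X !=set0;
  mh_closed : closed X;
  mh_invariant : invariant X;
  mh_directed : forall v1 v2, X v1 -> X v2 ->
    forall V1 V2, nbhs v1 V1 -> nbhs v2 V2 ->
    exists v, [/\ X v, orb_plus v `&` V1 !=set0 & orb_plus v `&` V2 !=set0] }.

Definition MH : set (set (vert E)) := [set X | maximal_head X].

Definition rho_BV (v : BV) : set (vert E) * set (vert E) :=
  (closure (orb_plus (val v)), orb_sub_sg (val v) `|` [set val v]).

Definition rho_MH (X : MH) : set (vert E) * set (vert E) :=
  let hX : maximal_head (val X) := set_valP X in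
  (val X, sub_sg (mh_closed hX) (proj1 (mh_invariant hX))).

Definition rho_of (x : BV + MH) : set (vert E) * set (vert E) :=
  match x with inl v => rho_BV v | inr X => rho_MH X end.

End PrimePairs.

Arguments prime_pairs : clear implicits.
Arguments BV : clear implicits.
Arguments MH : clear implicits.

(* Main.v *)
Require Import Defs.
From mathcomp Require Import all_boot all_order all_algebra.
From mathcomp Require Import all_classical all_reals topology.
Local Open Scope classical_set_scope.

(* Every regular vertex of X inside an invariant X stays regular, so X_sg lies
   in E_sg.  The prime property of the rho_x is proved by contradiction: if
   rho_x is not contained in (Y, Z), then some non-empty open part of X can only
   be reached from vertices outside Z; for a maximal head two such parts are
   reached from a common vertex, and for v in BV(E) they are reached from v.

   Conversely let (X, Z) be prime.  If Z contains a vertex v of X_rg, then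
   separating v from any other point of Z outside X_sg would split the pair, so
   Z = X_sg + v, and the splitting (X, X_sg) + rho_v gives X = closure Orb+(v).
   Otherwise Z = X_sg; if no vertex of X reached both V_1 and V_2, then the
   saturations of the open sets of vertices reaching V_1 and V_2 would still be
   disjoint in X, and their complements would be closed invariant sets covering
   X, neither of which contains X. *)

Set Implicit Arguments.
Unset Strict Implicit.
Unset Printing Implicit Defensive.

(** * Closures in subspaces and open sets defined by neighborhoods *)

Lemma closure_set_type (T : topologicalType) (A : set T) (B : set A) (x : A) :
  closure B x <-> closure (@set_val T A @` B) (set_val x).
Proof.
split=> clB V.
  move=> Vx; have [|y [By Vy]] := clB (@set_val T A @^-1` V).
    by apply/nbhs_set_type; exists V.
  by exists (set_val y); split=> //; exists y.
move=> /nbhs_set_type[W Wx WV]; have [_ [[y By <-] Wy]] := clB W Wx.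
by exists y; split=> //; exact: WV.
Qed.

(** Covers the finiteness conditions of the graph and of its subgraphs alike, with [P] a compactness
    condition. *)
Lemma open_exists_nbhs (T : topologicalType) (P : set T -> Prop) :
  open [set v | exists2 V, nbhs v V & P V].
Proof.
rewrite openE => v [V]; rewrite nbhsE => -[W [oW Wv] WV] cV.
rewrite /interior nbhsE; exists W => // w Ww; exists V => //.
by apply: filterS WV _; exact: open_nbhs_nbhs.
Qed.

(** * Forward orbits and their closures *)

Section Paths.
Variable E : topGraph.
Implicit Types (X S V : set (vert E)) (u v w : vert E).

Lemma orb_refl v : orb_plus v v.
Proof. by left. Qed.

Lemma orb_dom (e : edge E) w : orb_plus (rng e) w -> orb_plus (dom e) w.
Proof.
case=> [->|[f [p [fp lp rf]]]]; right; first by exists e, [::].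
exists f, (rcons p e); split=> //; last by rewrite last_rcons.
by rewrite rcons_path fp /= lp eqxx.
Qed.

Lemma orb_last v w : orb_plus v w ->
  w = v \/ exists2 e : edge E, rng e = w & orb_plus v (dom e).
Proof.
case=> [|[e [[|f p] [/= fp lp re]]]]; [by left| |].
  by right; exists e => //; left.
right; exists e => //; right; exists f, p.
by move: fp => /andP[/eqP-> fp].
Qed.

(** Induction along the path, from its range back to its source. The complement of a positively
    invariant set and the interior of a set of vertices are the instances of [S] that matter. *)
Lemma orb_pull S v w : (forall e : edge E, S (rng e) -> S (dom e)) ->
  orb_plus v w -> S w -> S v.
Proof.
move=> hS [->//|[e [p [ep <- <-]]]].
elim: p e ep => [|f p IH] e /=; first by move=> _; exact: hS.
by move=> /andP[/eqP ef fp] /hS; rewrite ef; exact: IH.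
Qed.

Lemma posinv_orb X v w : positively_invariant X ->
  orb_plus v w -> X v -> X w.
Proof.
move=> pX vw Xv; apply: contrapT => Xw.
by apply: (@orb_pull (~` X) v w) Xv => // e Xre Xde; exact: Xre (pX e Xde).
Qed.

Lemma closure_orb_sub X v : closed X -> positively_invariant X -> X v ->
  closure (orb_plus v) `<=` X.
Proof.
move=> cX pX Xv; rewrite [X in _ `<=` X](iffLR (closure_id X) cX).
by apply: closureS => w vw; exact: posinv_orb vw Xv.
Qed.

Lemma nbhs_dom (e : edge E) S : nbhs (rng e) S ->
  nbhs (dom e) (@dom E @` (@rng E @^-1` S)).
Proof.
rewrite nbhsE => -[V [oV Ve] VS].
apply: (@filterS _ _ _ (@dom E @` (@rng E @^-1` V))).
  by apply: image_subset => f; exact: VS.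
apply: open_nbhs_nbhs; split; last by exists e.
by apply: dom_open; move/continuousP : (@rng_continuous E); exact.
Qed.

(** Since [dom] is open and [rng] continuous, every vertex near [dom e] emits an edge ending near
    [rng e]; [orb_pull] carries this interior-point property back along the path. *)
Lemma open_orb_meets V : open V -> open [set v | orb_plus v `&` V !=set0].
Proof.
move=> oV; rewrite openE => v [w [vw Vw]]; rewrite /interior /=.
apply: (@orb_pull (fun x => nbhs x [set v | orb_plus v `&` V !=set0])) vw _.
  move=> e /nbhs_dom; apply: filterS => _ [f [x [fx Vx]] <-].
  by exists x; split=> //; exact: orb_dom.
apply: (@filterS _ _ _ V); last exact: open_nbhs_nbhs.
by move=> x Vx; exists x; split => //; exact: orb_refl.
Qed.

(* Over a neighbourhood with compact preimage, r is a closed map. *)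
Lemma fin_image_closed (C : set (edge E)) v : fin E v -> closed C ->
  closure (@rng E @` C) v -> exists2 e, C e & rng e = v.
Proof.
move=> [V Vv cV] cC clv.
suff: (@rng E @` (@rng E @^-1` V `&` C)) v by case=> e [_ Ce] <-; exists e.
have: compact (@rng E @` (@rng E @^-1` V `&` C)).
  apply: continuous_compact; last exact: compact_closedI.
  by apply: continuous_subspaceT; exact: rng_continuous.
move=> /(compact_closed (@vert_hausdorff E)); apply => B Bv.
have [_ [[e Ce <-] [Ve Be]]] := clv (V `&` B) (filterI Vv Bv).
by exists (rng e); split=> //; exists e.
Qed.

Lemma open_rg : open (rg E).
Proof.
apply: openI; last by apply: closed_openC; exact: closed_closure.
exact: open_exists_nbhs.
Qed.

Lemma closed_sg : closed (sg E).
Proof. by apply: open_closedC; exact: open_rg. Qed.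

Lemma closure_orb_invariant v : sg E v -> Defs.invariant (closure (orb_plus v)).
Proof.
move=> sv; split; first exact: closure_orb_posinv.
move=> u [clu ru].
have cC := @closed_dom_preimage E _ (@closed_closure _ (orb_plus v)).
have [|e Ce eu] := fin_image_closed ru.1 cC; last by exists e.
(* Orbit points near the regular [u] are regular, hence differ from the singular [v] and are entered
   by an edge from the orbit; closedness of r at [u] then gives the edge into [u] itself. *)
move=> B Bu; have [|w [vw [Bw rw]]] := clu (B `&` rg E).
  by apply: filterI => //; apply: open_nbhs_nbhs; split => //; exact: open_rg.
case: (orb_last vw) => [wv|[e ew ve]]; first by rewrite wv in rw.
by exists w; split => //; exists e => //=; exact: subset_closure.
Qed.

(** * Saturations of hereditary sets *)

Section Saturation.
Variable H : set (vert E).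

(** An inductive predicate, because a regular vertex may receive infinitely many edges; its
    complement is negatively invariant by construction. *)
Inductive saturation : vert E -> Prop :=
| sat_base v : H v -> saturation v
| sat_step v : rg E v -> (forall e : edge E, rng e = v -> saturation (dom e)) ->
    saturation v.

Hypothesis hH : forall e : edge E, H (rng e) -> H (dom e).

Lemma sat_dom (e : edge E) : saturation (rng e) -> saturation (dom e).
Proof.
suff Sdom v : saturation v -> rng e = v -> saturation (dom e) by move=> /Sdom; exact.
case=> {}v; first by move=> Hv ev; apply: sat_base; apply: hH; rewrite ev.
by move=> rv Sv ev; exact: Sv.
Qed.

(** In the inductive step, the edges starting outside the interior form a closed set whose image
    under [rng] stays away from the regular vertex [v]; so near [v] all incoming edges start in the
    saturation. *)
Lemma open_saturation : open H -> open saturation.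
Proof.
move=> oH; rewrite openE => v; rewrite /interior /=.
elim=> {}v; first move=> Hv.
  apply: (@filterS _ _ _ H); first exact: sat_base.
  exact: open_nbhs_nbhs.
move=> rv _ IH.
have cC : closed (@dom E @^-1` ~` saturation^°).
  rewrite -preimage_setC; apply: open_closedC.
  by move/continuousP : (@dom_continuous E); apply; exact: open_interior.
have : nbhs v (~` closure (@rng E @` (@dom E @^-1` ~` saturation^°))).
  apply: open_nbhs_nbhs; split; first by apply: closed_openC; exact: closed_closure.
  by move=> /(fin_image_closed rv.1 cC)[e eS /IH].
have : nbhs v (rg E) by apply: open_nbhs_nbhs; split => //; exact: open_rg.
apply: filterS2 => w rw clw; apply: sat_step => // e ew.
apply: contrapT => Sde; apply: clw; apply: subset_closure.
by exists e => //= /interior_subset.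
Qed.

Lemma saturationC_invariant : Defs.invariant (~` saturation).
Proof.
split; first by move=> e nde re; apply: nde; exact: sat_dom.
move=> v [nSv rv]; apply: contrapT => ne; apply: nSv; apply: sat_step => // e ev.
by apply: contrapT => Sde; apply: ne; exists e.
Qed.

End Saturation.

(** A common point added by a saturation step is regular, so negative invariance of [X] gives an
    edge into it from [X], whose source is again a common point. Both derivations are unwound in
    this way down to [H1] and [H2]. *)
Lemma saturation_disjoint X (H1 H2 : set (vert E)) : Defs.invariant X ->
    (forall e : edge E, H1 (rng e) -> H1 (dom e)) ->
    (forall e : edge E, H2 (rng e) -> H2 (dom e)) ->
    (forall v, X v -> H1 v -> ~ H2 v) ->
  forall v, X v -> saturation H1 v -> ~ saturation H2 v.
Proof.
move=> [_ nX] h1 h2 dis v Xv S1; elim: S1 Xv => {}v.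
  move=> H1v Xv S2; elim: S2 Xv H1v => {}v; first by move=> H2v Xv H1v; exact: dis H2v.
  move=> rv _ IH Xv H1v; have [//|e ev Xde] := nX v.
  by apply: (IH e) => //; apply: h1; rewrite ev.
move=> rv _ IH Xv S2v; have [//|e ev Xde] := nX v.
by apply: (IH e ev Xde); apply: sat_dom => //; rewrite ev.
Qed.

End Paths.

(** * Regular and singular vertices of a subgraph, seen in the ambient graph *)

Section RelativeVertices.
Variable E : topGraph.
Implicit Types (X Y Z : set (vert E)) (v w : vert E).

(* These are X^0_sce, X^0_fin, X^0_rg and X^0_sg for the subgraph with edge set
   X^1 = d^-1(X), described inside E^0 instead of in the subtype. *)
Definition rel_sce X := X `\` closure (@rng E @` (@dom E @^-1` X)).

Definition rel_fin X : set (vert E) :=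
  [set v | exists2 V, nbhs v V & compact (@rng E @^-1` V `&` @dom E @^-1` X)].

Definition rel_rg X := (X `&` rel_fin X) `\` closure (rel_sce X).

Definition rel_sg X := X `\` rel_rg X.

Section Subgraph.
Variables (X : set (vert E)) (cX : closed X) (pX : positively_invariant X).

Lemma sub_sceE : @set_val _ X @` sce (subgraph cX pX) = rel_sce X.
Proof.
rewrite /rel_sce (_ : @rng E @` (@dom E @^-1` X) =
    @set_val _ X @` range (@rng (subgraph cX pX))); last first.
  apply/seteqP; split=> [_ [e Xe <-]|_ [_ [e _ <-] <-]].
    by exists (sub_rng pX (SigSub (mem_set Xe))) => //; exists (SigSub (mem_set Xe)).
  by exists (set_val e) => //; exact: set_valP.
apply/seteqP; split=> [_ [x nx <-]|v [Xv nv]].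
  by split; [exact: set_valP|move=> /closure_set_type].
by exists (SigSub (mem_set Xv)) => //= /closure_set_type.
Qed.

Lemma sub_finP (x : X) : fin (subgraph cX pX) x <-> rel_fin X (set_val x).
Proof.
split=> [[V /nbhs_set_type[W Wx WV] cV]|[V Vx cV]].
  (* Adding the complement of [X] gives a neighborhood in the ambient space without new edges, as
     edges starting in [X] also end in [X]. *)
  exists (@set_val _ X @` V `|` ~` X).
    apply: filterS Wx => v Wv; have [Xv|] := pselect (X v); last by right.
    by left; exists (SigSub (mem_set Xv)) => //; exact: WV.
  suff -> : @rng E @^-1` (@set_val _ X @` V `|` ~` X) `&` @dom E @^-1` X =
      @set_val _ (@dom E @^-1` X) @` (@rng (subgraph cX pX) @^-1` V).
    apply: continuous_compact; last exact: cV.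
    by apply: continuous_subspaceT; exact: initial_continuous.
  apply/seteqP; split=> [e [[[y Vy ye]|nXe] Xe]|_ [e Ve <-]].
  - exists (SigSub (mem_set Xe)) => //=.
    by rewrite (_ : sub_rng _ _ = y)//; exact: val_inj.
  - by case: nXe; exact: (pX Xe).
  - split; last exact: set_valP.
    by left; exists (sub_rng pX e).
exists (@set_val _ X @^-1` V); first by apply/nbhs_set_type; exists V.
suff -> : @rng (subgraph cX pX) @^-1` (@set_val _ X @^-1` V) =
    @set_val _ (@dom E @^-1` X) @^-1` (@rng E @^-1` V `&` @dom E @^-1` X).
  exact: set_type_compact (closed_dom_preimage cX) cV.
by apply/seteqP; split=> e /= Ve; [split => //; exact: (@set_valP _ (@dom E @^-1` X) e)|case: Ve].
Qed.

Lemma sub_rgE : sub_rg cX pX = rel_rg X.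
Proof.
apply/seteqP; split=> [_ [x [fx sx] <-]|v [[Xv fv] sv]].
  split; first by split; [exact: set_valP|exact/sub_finP].
  by rewrite -sub_sceE; move=> /closure_set_type.
exists (SigSub (mem_set Xv)) => //; split; first exact/sub_finP.
by move=> /closure_set_type; rewrite sub_sceE.
Qed.

Lemma sub_sgE : sub_sg cX pX = rel_sg X.
Proof.
rewrite /rel_sg -sub_rgE; apply/seteqP; split=> [_ [x sx <-]|v [Xv rv]].
  by split; [exact: set_valP|case=> y ry /val_inj yx; apply: sx; rewrite -yx].
exists (SigSub (mem_set Xv)) => // rx; apply: rv.
by exists (SigSub (mem_set Xv)).
Qed.

End Subgraph.

Lemma rel_rg_open X : open [set v | rel_fin X v /\ ~ closure (rel_sce X) v].
Proof.
apply: openI; last by apply: closed_openC; exact: closed_closure.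
exact: open_exists_nbhs.
Qed.

Lemma closed_rel_sg X : closed X -> closed (rel_sg X).
Proof.
move=> cX; suff -> : rel_sg X =
    X `&` ~` [set v | rel_fin X v /\ ~ closure (rel_sce X) v].
  by apply: closedI => //; apply: open_closedC; exact: rel_rg_open.
apply/seteqP; split=> v [Xv nv]; split=> //.
  by move=> [fv sv]; apply: nv.
by move=> [[_ fv] sv]; apply: nv.
Qed.

Lemma rel_sce_sg X : rel_sce X `<=` rel_sg X.
Proof.
move=> v sv; split; first by case: sv.
by move=> [_]; apply; exact: subset_closure.
Qed.

Lemma rel_fin_sub X Y : closed X -> X `<=` Y -> rel_fin Y `<=` rel_fin X.
Proof.
move=> cX XY v [V Vv cV]; exists V => //.
apply: (subclosed_compact _ cV) => [|e [Ve /XY]//].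
rewrite (_ : _ `&` _ =
  (@rng E @^-1` V `&` @dom E @^-1` Y) `&` @dom E @^-1` X).
  apply: closedI; last exact: closed_dom_preimage.
  exact: (compact_closed (@edge_hausdorff E)).
by apply/seteqP; split=> [e [Ve Xe]|e [[Ve _] Xe]]; do ?split => //; exact: XY.
Qed.

(** Suppose [v] is regular in [E]. Finiteness passes to [X], and nearby vertices of [X] are regular
    in [E], so by negative invariance they receive edges from [X] and are not in [rel_sce X]. *)
Lemma rel_sg_sub_sg X : closed X -> Defs.invariant X -> rel_sg X `<=` sg E.
Proof.
move=> cX [_ nX] v [Xv sv] rv; apply: sv; split; first split=> //.
  apply: (@rel_fin_sub X setT) => //.
  by case: rv => -[V Vv cV] _; exists V; rewrite // preimage_setT setIT.
move=> /(_ (rg E))[|w [[Xw nw] rw]].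
  by apply: open_nbhs_nbhs; split => //; exact: open_rg.
have [//|e ew Xe] := nX w; apply: nw; apply: subset_closure.
by exists e.
Qed.

Lemma admissibleP (rho : set (vert E) * set (vert E)) : admissible rho <->
  [/\ closed rho.1, Defs.invariant rho.1, closed rho.2,
      rel_sg rho.1 `<=` rho.2 & rho.2 `<=` sg E `&` rho.1].
Proof.
split=> [[cX iX cZ]|[cX iX cZ sZ Zs]]; first by rewrite sub_sgE; split.
by exists cX iX => //; rewrite sub_sgE.
Qed.

(* If [rho] is not contained in [(Y, Z)], then [(Y, Z)] is avoided by every [w]
   whose orbit reaches a suitable open set: either the complement of [Y], or a
   set of sources of [X] outside [Z], which no orbit in [X] enters from
   elsewhere. *)
Lemma escape X Y Z : positively_invariant X -> closed X ->
    positively_invariant Y -> closed Y -> closed Z -> rel_sg Y `<=` Z ->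
    ~ (X `<=` Y /\ rel_sg X `<=` Z) ->
  exists v V, [/\ X v, nbhs v V & forall w, X w ->
    orb_plus w `&` V !=set0 -> ~ Y w \/ rel_sg X w /\ ~ Z w].
Proof.
move=> pX cX pY cY cZ YZ; have [XY nZ|nXY _] := pselect (X `<=` Y); last first.
  have [v [Xv nYv]] : exists v, X v /\ ~ Y v.
    by apply: contrapT => n; apply: nXY => v Xv; apply: contrapT => Yv; apply: n; exists v.
  exists v, (~` Y); split => //.
    by apply: open_nbhs_nbhs; split => //; exact: closed_openC.
  by move=> w Xw [u [wu nYu]]; left => Yw; apply: nYu; exact: posinv_orb Yw.
have [v [sv nZv]] : exists v, rel_sg X v /\ ~ Z v.
  apply: contrapT => n; apply: nZ; split => // v Xv.
  by apply: contrapT => Zv; apply: n; exists v.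
have Xv : X v by case: sv.
(* Finiteness of [v] passes from [Y] to [X], so [v] can be singular in [X] only as a limit of
   [rel_sce X]. *)
have [[_ fv] _] : rel_rg Y v.
  apply: contrapT => nrv; apply: nZv; apply: YZ; split => //; exact: XY.
have clv : closure (rel_sce X) v.
  apply: contrapT => ncl; case: sv => _; apply; split => //; split => //.
  exact: rel_fin_sub fv.
have oZ : open (~` Z) by exact: closed_openC.
have [|u [[Xu nu] nZu]] := clv (~` Z); first by apply: open_nbhs_nbhs.
exists u, (~` closure (@rng E @` (@dom E @^-1` X)) `&` ~` Z); split=> //.
  apply: open_nbhs_nbhs; split => //; apply: openI => //.
  by apply: closed_openC; exact: closed_closure.
move=> w Xw [x [wx [nx nZx]]]; right.
case: (orb_last wx) => [xw|[e ex we]]; last first.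
  case: nx; apply: subset_closure; exists e => //=; exact: posinv_orb we Xw.
by rewrite -xw; split => //; apply: rel_sce_sg; split => //; rewrite xw.
Qed.

(** * Primality of the pairs in the image *)

Lemma orb_sub_rgE v : orb_sub_rg v = rel_rg (closure (orb_plus v)).
Proof. exact: sub_rgE. Qed.

Lemma orb_sub_sgE v : orb_sub_sg v = rel_sg (closure (orb_plus v)).
Proof. exact: sub_sgE. Qed.

Lemma rho_BVE (v : BV E) : rho_BV v = (closure (orb_plus (set_val v)),
  rel_sg (closure (orb_plus (set_val v))) `|` [set (set_val v)]).
Proof. by rewrite /rho_BV orb_sub_sgE. Qed.

Lemma rho_MHE (X : MH E) : rho_MH X = (set_val X, rel_sg (set_val X)).
Proof. by rewrite /rho_MH sub_sgE. Qed.

Lemma closed_singleton v : closed [set v].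
Proof.
by apply: accessible_closed_set1; apply: hausdorff_accessible; exact: vert_hausdorff.
Qed.

Lemma maximal_head_prime X : maximal_head X -> prime_pairs E (X, rel_sg X).
Proof.
move=> [[x Xx] cX iX dX]; split.
- apply/admissibleP; split => //=; first exact: closed_rel_sg.
  by move=> v sv; split; [exact: (rel_sg_sub_sg cX iX)|case: sv].
- by move=> [X0]; rewrite X0 in Xx.
move=> [Y1 Z1] [Y2 Z2] /admissibleP[/= c1 [p1 _] d1 s1 h1].
move=> /admissibleP[/= c2 [p2 _] d2 s2 h2] [/= XY XZ].
apply: contrapT => /not_orP[n1 n2].
have [v1 [V1 [Xv1 V1v1 e1]]] := escape iX.1 cX p1 c1 d1 s1 n1.
have [v2 [V2 [Xv2 V2v2 e2]]] := escape iX.1 cX p2 c2 d2 s2 n2.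
have [w [Xw /(e1 _ Xw) w1 /(e2 _ Xw) w2]] := dX _ _ Xv1 Xv2 _ _ V1v1 V2v2.
(* Either way of escaping avoids [Z1], and likewise [Z2], so [w] is not singular in [X]. Hence [w]
   avoids both [Y1] and [Y2], which cover [X]. *)
have nZ1 : ~ Z1 w by case: w1 => [nY /h1[]|[]].
have nZ2 : ~ Z2 w by case: w2 => [nY /h2[]|[]].
have nsg : ~ rel_sg X w by move=> /XZ[].
case: w1 => [nY1|[]//]; case: w2 => [nY2|[]//].
by case: (XY _ Xw).
Qed.

(** Stated for all singular [v], so that [prime_BV] can use the pair before [BV E v] is
    established. *)
Lemma orb_admissible v : sg E v -> admissible (closure (orb_plus v),
  rel_sg (closure (orb_plus v)) `|` [set v]).
Proof.
set X := closure (orb_plus v) => sv.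
have cX : closed X by exact: closed_closure.
have iX : Defs.invariant X by exact: closure_orb_invariant.
apply/admissibleP; split => //=.
  by apply: closedU; [exact: closed_rel_sg|exact: closed_singleton].
move=> w [sw|->]; first by split; [exact: (rel_sg_sub_sg cX iX)|case: sw].
by split=> //; apply: subset_closure; exact: orb_refl.
Qed.

Lemma BV_prime v : BV E v -> prime_pairs E (closure (orb_plus v),
  rel_sg (closure (orb_plus v)) `|` [set v]).
Proof.
set X := closure (orb_plus v) => -[sv]; rewrite orb_sub_rgE -/X => rv.
have cX : closed X by exact: closed_closure.
have iX : Defs.invariant X by exact: closure_orb_invariant.
have Xv : X v by apply: subset_closure; exact: orb_refl.
(* The orbit of [v] is dense in [X], so it meets the open set given by [escape], and [v] itself
   would have to avoid [Y] or [Z]. *)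
have main Y Z : admissible (Y, Z) -> Z v -> pair_sub (X, rel_sg X `|` [set v]) (Y, Z).
  move=> /admissibleP[/= cY [pY _] cZ sZ hZ] Zv; apply: contrapT => n.
  have [|u [V [Xu Vu /(_ v Xv)]]] := escape iX.1 cX pY cY cZ sZ.
    by move=> [XY XZ]; apply: n; split => //= w [/XZ//|->].
  have [_ Yv] := hZ _ Zv.
  by case=> [|//|[]//]; exact: Xu.
split; first exact: orb_admissible.
- by move=> [X0]; rewrite X0 in Xv.
move=> [Y1 Z1] [Y2 Z2] a1 a2 [_ /= /(_ v)[]]; first by right.
- by left; exact: main.
- by right; exact: main.
Qed.

(** * Every prime pair lies in the image *)

Lemma prime_sg_maximal_head X : prime_pairs E (X, rel_sg X) -> maximal_head X.
Proof.
move=> [/admissibleP[/= cX iX _ _ _] n0 pr]; split => //.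
  apply: contrapT => /nonemptyPn X0; apply: n0.
  by rewrite X0 /rel_sg set0D.
move=> v1 v2 Xv1 Xv2 V1' V2'; rewrite !nbhsE.
move=> -[V1 [oV1 V1v1] V1V] -[V2 [oV2 V2v2] V2V].
suff: exists w, [/\ X w, orb_plus w `&` V1 !=set0 & orb_plus w `&` V2 !=set0].
  move=> [w [Xw [x1 [wx1 Vx1]] [x2 [wx2 Vx2]]]].
  by exists w; split => //; [exists x1|exists x2]; split=> //; [exact: V1V|exact: V2V].
apply: contrapT => ndir.
(* Including the complement of [X] keeps [Y V] below inside [X]. *)
pose H V := [set v | orb_plus v `&` V !=set0] `|` ~` X.
have hH V (e : edge E) : H V (rng e) -> H V (dom e).
  move=> [[x [ex Vx]]|nXe]; last by right => Xe; apply: nXe; exact: iX.1.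
  by left; exists x; split => //; exact: orb_dom.
pose Y V : set (vert E) := ~` saturation (H V).
have YX V : Y V `<=` X.
  by move=> v; apply: contra_notP => nXv; apply: sat_base; right.
(* The largest admissible second component is taken, so only the first components can obstruct
   containment. *)
have aY V : open V -> admissible (Y V, sg E `&` Y V).
  move=> oV; have cY : closed (Y V).
    apply: open_closedC; apply: open_saturation => //.
    by apply: openU; [exact: open_orb_meets|exact: closed_openC].
  have iY : Defs.invariant (Y V) by apply: saturationC_invariant => e; exact: hH.
  apply/admissibleP; split => //=; first by apply: closedI => //; exact: closed_sg.
  by move=> v sv; split; [exact: (rel_sg_sub_sg cY iY)|case: sv].
have nY V v : V v -> ~ Y V v.
  by move=> Vv; apply; apply: sat_base; left; exists v; split => //; exact: orb_refl.
have XY : X `<=` Y V1 `|` Y V2.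
  move=> v Xv; have [S1|] := pselect (saturation (H V1) v); last by left.
  right; apply: (saturation_disjoint iX (@hH V1) (@hH V2) _ Xv S1) => w Xw [H1|//] [H2|//].
  by apply: ndir; exists w.
case: (pr _ _ (aY _ oV1) (aY _ oV2)).
- split => //= v sv; have sgv := rel_sg_sub_sg cX iX sv.
  by case: sv => /XY[Yv|Yv] _; [left|right].
- by move=> [/= /(_ _ Xv1) Yv1 _]; exact: (nY V1 v1).
- by move=> [/= /(_ _ Xv2) Yv2 _]; exact: (nY V2 v2).
Qed.

Lemma prime_BV X Z v : prime_pairs E (X, Z) -> Z v -> rel_rg X v ->
  BV E v /\ (X, Z) = (closure (orb_plus v),
    rel_sg (closure (orb_plus v)) `|` [set v]).
Proof.
move=> [/admissibleP[/= cX iX cZ sZ hZ] _ pr] Zv rv.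
have [sv Xv] := hZ _ Zv.
have csX : closed (rel_sg X) by exact: closed_rel_sg.
have rgNsg w : rel_rg X w -> ~ rel_sg X w by move=> rw [].
have aX W : closed W -> rel_sg X `<=` W -> W `<=` Z -> admissible (X, W).
  by move=> cW sW WZ; apply/admissibleP; split => //= w /WZ /hZ.
have ZE : Z = rel_sg X `|` [set v].
  apply/seteqP; split=> [u Zu|u [/sZ//|-> //]].
  apply: contrapT => /not_orP[nsu /eqP uv].
  have oR : open (~` rel_sg X) by exact: closed_openC.
  have := @vert_hausdorff E; rewrite open_hausdorff => /(_ _ _ uv).
  move=> [[U V] /= [Uu Vv] [oU oV /eqP UV]]; rewrite !inE in Uu Vv.
  (* Deleting from [Z] the part of [U], respectively [V], outside [rel_sg X] gives two closed sets
     that still cover [Z], as [U] and [V] are disjoint; the first misses [u], the second [v]. *)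
  have aA W : open W -> admissible (X, Z `&` ~` (W `&` ~` rel_sg X)).
    move=> oW; apply: aX; last by move=> w [].
      by apply: closedI => //; apply: open_closedC; exact: openI.
    by move=> w sw; split; [exact: sZ|move=> []].
  case: (pr _ _ (aA _ oU) (aA _ oV)).
  - split=> [w|/= w Zw] /=; first by left.
    have [Uw|] := pselect (U w); last by left; split => // -[].
    right; split => // -[Vw _].
    by have : (U `&` V) w by []; rewrite UV.
  - by move=> [_ /= /(_ _ Zu)[_]]; apply.
  - by move=> [_ /= /(_ _ Zv)[_]]; apply; split => //; exact: rgNsg.
set Y := closure (orb_plus v).
have XY : X = Y.
  apply/seteqP; split; last exact: closure_orb_sub iX.1 Xv.
  (* The first pair misses [v], so primeness forces containment in the second, whose first component
     is [Y]. *)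
  case: (pr (X, rel_sg X) _ (aX _ csX _ sZ) (orb_admissible sv)) => //.
  - split=> /= w; first by left.
    by rewrite ZE => -[|->]; [left|right; right].
  - by move=> [_ /= /(_ _ Zv) /(rgNsg _ rv)].
  - by case.
by split; [split => //; rewrite orb_sub_rgE -/Y -XY|rewrite ZE -XY].
Qed.

End RelativeVertices.

Theorem proposition9p8 (E : topGraph) :
  set_bij [set: (BV E + MH E)%type] (prime_pairs E) (@rho_of E).
Proof.
have BVrg (v : BV E) : rel_rg (closure (orb_plus (set_val v))) (set_val v).
  by rewrite -orb_sub_rgE; case: (set_valP v).
split.
- move=> [v|X] _ /=.
    by rewrite rho_BVE; apply: BV_prime; exact: set_valP.
  by rewrite rho_MHE; apply: maximal_head_prime; exact: set_valP.
(* The second component of [rho_BV v] has [v] as its only element regular in the subgraph, so [v] is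
   recovered from the pair; that of [rho_MH X] has no such element. *)
- move=> [v|X] [w|Y] _ _ /=; rewrite ?rho_BVE ?rho_MHE => -[].
  + move=> XY ZE; congr inl; apply: val_inj => /=.
    have : (rel_sg (closure (orb_plus (set_val w))) `|` [set (set_val w)]) (set_val v).
      by rewrite -ZE; right.
    case=> [|//]; rewrite -XY => -[_ /(_ (BVrg v))//].
  + move=> XY ZE.
    have : rel_sg (set_val Y) (set_val v) by rewrite -ZE; right.
    by rewrite -XY => -[_ /(_ (BVrg v))].
  + move=> XY ZE.
    have : rel_sg (set_val X) (set_val w) by rewrite ZE; right.
    by rewrite XY => -[_ /(_ (BVrg w))].
  + by move=> XY _; congr inr; exact: val_inj.
- move=> [X Z] pr.
  have [[v [Zv rv]]|nZ] := pselect (exists v, Z v /\ rel_rg X v).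
    have [Bv ->] := prime_BV pr Zv rv.
    by exists (inl (SigSub (mem_set Bv))) => //=; rewrite rho_BVE.
  have ZE : Z = rel_sg X.
    case: pr => /admissibleP[/= _ _ _ sZ hZ] _ _; apply/seteqP; split => // v Zv.
    by split; [case: (hZ _ Zv)|move=> rv; apply: nZ; exists v].
  rewrite ZE in pr *; have hX := prime_sg_maximal_head pr.
  by exists (inr (SigSub (mem_set (hX : MH E X)))) => //=; rewrite rho_MHE.
Qed.
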